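(* Let $A$ be a commutative Noetherian ring. Define a relation $\sim$ on $ic(A)$ by: $I\sim J$ if and only if there are nonzero $f,g\in A$ such that $\overline{fI}=\overline{gJ}$, for $I,J\in ic(A)$. Then $\sim$ is a congruence on the monoid $(ic(A),* )$ (an equivalence relation such that $I\sim J$ and $K\sim H$ imply $I*K\sim J*H$), and $ic(A)/{\sim}$ is a cancellative monoid.
   Context: For an ideal $I$ of a commutative Noetherian ring $A$, the integral closure is $\overline{I}=\{x\in A : x^n+a_1x^{n-1}+\dots+a_{n-1}x+a_n=0 \text{ for some } n\in\mathbb{N},\ a_i\in I^i \text{ for } 1\le i\le n\}$; $I$ is integrally closed if $\overline{I}=I$. Define $ic(A)=\{I : I \text{ is an integrally closed ideal of } A \text{ and } I \text{ contains a nonzerodivisor}\}$, with operation $I*J=\overline{IJ}$; this is a commutative monoid with identity $(1)$. A commutative monoid is cancellative if $a*c=b*c$ implies $a=b$.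
   Formalization: In the definition of the relation, f and g are required to be nonzerodivisors rather than merely nonzero; with nonzero f, g the relation is not transitive, e.g. in B×B with B=k[x,y]. Over a domain the two conditions agree. *)

(* Defs.v *)
From HB Require Import structures.
From mathcomp Require Import all_boot all_order all_algebra.
From mathcomp Require Import boolp classical_sets.

Set Implicit Arguments.
Unset Strict Implicit.
Unset Printing Implicit Defensive.

Import GRing.Theory.
Local Open Scope classical_set_scope.
Local Open Scope ring_scope.

Section Monoids.
Variable T : Type.

(* Monoids carried by a subset S of T: op is a total function on T, but only
   its values on S matter. *)
Definition comm_monoid (S : set T) (op : T -> T -> T) (e : T) : Prop :=
  [/\ S e,
      forall x y, S x -> S y -> S (op x y),
      forall x y z, S x -> S y -> S z -> op x (op y z) = op (op x y) z,
      forall x y, S x -> S y -> op x y = op y x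
    & forall x, S x -> op e x = x].

Definition cancellative (S : set T) (op : T -> T -> T) : Prop :=
  forall a b c, S a -> S b -> S c -> op a c = op b c -> a = b.

Definition equivalence_on (S : set T) (R : T -> T -> Prop) : Prop :=
  [/\ forall x, S x -> R x x,
      forall x y, S x -> S y -> R x y -> R y x
    & forall x y z, S x -> S y -> S z -> R x y -> R y z -> R x z].

Definition congruence (S : set T) (op : T -> T -> T) (R : T -> T -> Prop) :
    Prop :=
  equivalence_on S R /\
  forall x y z w, S x -> S y -> S z -> S w ->
    R x y -> R z w -> R (op x z) (op y w).

Definition eq_class (S : set T) (R : T -> T -> Prop) (x : T) : set T :=
  [set y | S y /\ R x y].

Definition quot (S : set T) (R : T -> T -> Prop) : set (set T) :=
  [set eq_class S R x | x in S].

(* Saturating the set of products of representatives makes this total; it is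
   the usual operation on classes when R is a congruence (quot_op_class). *)
Definition quot_op (S : set T) (op : T -> T -> T) (R : T -> T -> Prop)
    (C D : set T) : set T :=
  [set z | S z /\ exists x y, [/\ C x, D y & R (op x y) z]].

Lemma quot_op_class (S : set T) (op : T -> T -> T) (R : T -> T -> Prop) x y :
    (forall u v, S u -> S v -> S (op u v)) -> congruence S op R ->
    S x -> S y ->
  quot_op S op R (eq_class S R x) (eq_class S R y) = eq_class S R (op x y).
Proof.
move=> Sop [[Rxx Rsym Rtr] Rop] Sx Sy; apply/seteqP; split=> z /=.
  move=> [Sz [u [v [[Su xu] [Sv yv] uvz]]]]; split=> //.
  by apply: (Rtr _ (op u v)); rewrite //; [exact: Sop | exact: Sop | exact: Rop].
move=> [Sz xyz]; split=> //; exists x, y.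
by split=> //; split=> //; exact: Rxx.
Qed.

End Monoids.

Section Ideals.
Variable A : comPzRingType.
Implicit Types I J : set A.

Definition is_ideal I : Prop :=
  [/\ I 0, forall x y, I x -> I y -> I (x + y)
    & forall a x, I x -> I (a * x)].

Definition ideal_span (X : set A) : set A := smallest is_ideal X.

Definition noetherian : Prop :=
  forall I, is_ideal I -> exists s : seq A, I = ideal_span [set` s].

Definition ideal_mul I J : set A :=
  ideal_span [set x * y | x in I & y in J].

Definition ideal_exp I (n : nat) : set A := iter n (ideal_mul I) setT.

Definition ideal_scale (f : A) I : set A := [set f * x | x in I].

Definition int_closure I : set A :=
  [set x | exists (n : nat) (a : nat -> A),
     [/\ (0 < n)%N,
         forall i, (1 <= i <= n)%N -> ideal_exp I i (a i)
       & x ^+ n + \sum_(1 <= i < n.+1) a i * x ^+ (n - i) = 0]].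

(* As A is commutative, GRing.lreg f says that f is a nonzerodivisor. *)
Definition ic : set (set A) :=
  [set I | [/\ is_ideal I, int_closure I = I & exists2 x, I x & GRing.lreg x]].

Definition ic_mul I J : set A := int_closure (ideal_mul I J).

(* The multipliers f and g are nonzerodivisors.  Over a domain this just means
   nonzero (ic_simE), but if f and g could be arbitrary nonzero elements the
   relation would not be transitive in general.  In A = B x B with B = k[x, y]
   and m = (x, y), the multiplier (0, 1) relates m x B to B x B, and (1, 0)
   relates B x B to B x m, but m x B and B x m are not related since no
   nonzero multiple of m has the same integral closure as a principal ideal. *)
Definition ic_sim I J : Prop :=
  exists f g : A, [/\ GRing.lreg f, GRing.lreg g
    & int_closure (ideal_scale f I) = int_closure (ideal_scale g J)].

End Ideals.

Lemma ic_simE (A : idomainType) (I J : set A) :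
  ic_sim I J <->
  exists f g : A, [/\ f != 0, g != 0
    & int_closure (ideal_scale f I) = int_closure (ideal_scale g J)].
Proof.
by split=> -[f [g [fr gr fIgJ]]]; exists f, g; split=> //; apply/lregP.
Qed.

(* Main.v *)
(** For ideals containing a nonzerodivisor in a Noetherian ring, [I] is
    contained in the integral closure of [J] if and only if [I N] is contained
    in [J N] for some ideal [N] containing a nonzerodivisor: an equation of
    integral dependence of degree [m + 1] for [x] over [J] gives
    [x N <= J N] with [N = (J + (x))^m], and conversely [x N <= J N] gives an
    equation by the determinant trick.  The second condition is visibly a
    preorder compatible with products, and it is cancellable since [N] may
    absorb any factor; this yields the congruence and the cancellation. *)
Require Import Defs.
From mathcomp Require Import all_boot all_order all_algebra fingroup perm.
From mathcomp Require Import boolp classical_sets.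

Set Implicit Arguments.
Unset Strict Implicit.
Unset Printing Implicit Defensive.

Import GRing.Theory.
Local Open Scope classical_set_scope.
Local Open Scope ring_scope.

(** * Quotients of commutative monoids by a congruence *)

Section Quotient.
Variables (T : Type) (S : set T) (op : T -> T -> T) (R : T -> T -> Prop).

Lemma eq_classP x y : equivalence_on S R -> S x -> S y ->
  eq_class S R x = eq_class S R y <-> R x y.
Proof.
move=> [Rxx Rsym Rtr] Sx Sy; split=> [exy|xy].
  have : eq_class S R y y by split=> //; exact: Rxx.
  by rewrite -exy => -[].
apply/seteqP; split=> z [Sz Rz]; split=> //; last exact: Rtr xy Rz.
by apply: Rtr Rz => //; exact: Rsym.
Qed.

Lemma comm_monoid_quot e : comm_monoid S op e -> congruence S op R ->
  comm_monoid (quot S R) (quot_op S op R) (eq_class S R e).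
Proof.
move=> [Se Sop opA opC op1] Rcong.
have opE := quot_op_class Sop Rcong.
split; first by exists e.
- by move=> _ _ [x Sx <-] [y Sy <-]; rewrite opE //; exists (op x y) => //; exact: Sop.
- move=> _ _ _ [x Sx <-] [y Sy <-] [z Sz <-].
  by rewrite !opE ?opA //; exact: Sop.
- by move=> _ _ [x Sx <-] [y Sy <-]; rewrite !opE // opC.
- by move=> _ [x Sx <-]; rewrite opE // op1.
Qed.

(** Passing to representatives, equality of classes becomes [R], so cancellation need only be
    checked for [op] up to [R]. *)
Lemma cancellative_quot :
    (forall x y, S x -> S y -> S (op x y)) -> congruence S op R ->
    (forall x y z, S x -> S y -> S z -> R (op x z) (op y z) -> R x y) ->
  cancellative (quot S R) (quot_op S op R).
Proof.
move=> Sop Rcong Rcanc _ _ _ [x Sx <-] [y Sy <-] [z Sz <-].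
have [Req _] := Rcong; rewrite !quot_op_class // => /eq_classP Rxy.
by apply/eq_classP => //; apply: (Rcanc x y z) => //; apply: Rxy => //; exact: Sop.
Qed.

End Quotient.

(** * Products and powers of ideals *)

Section Ideals.
Variable A : comPzRingType.
Implicit Types (I J K L M N X : set A) (x y z f g : A) (s : seq A).

Lemma ideal_span_is_ideal X : is_ideal (ideal_span X).
Proof.
split=> [L [[]]//|x y Xx Xy L LX|a x Xx L LX].
  by have [[_ LD _] _] := LX; apply: LD; [exact: Xx | exact: Xy].
by have [[_ _ LM] _] := LX; apply: LM; exact: Xx.
Qed.

Lemma ideal_span_min X L : is_ideal L -> X `<=` L -> ideal_span X `<=` L.
Proof. exact: smallest_sub. Qed.

Lemma ideal_setT : is_ideal [set: A].
Proof. by []. Qed.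

(** This is the colon ideal [L : x]. With [ideal_span_min] it reduces a claim [x * y] in [L], for
    [y] in a span, to the generators of the span. *)
Lemma ideal_colon x L : is_ideal L -> is_ideal [set y | L (x * y)].
Proof.
move=> [L0 LD LM]; split=> /= [|y z Ly Lz|a y Ly]; rewrite ?mulr0 ?mulrDr //.
  exact: LD.
by rewrite mulrCA; exact: LM.
Qed.

Lemma ideal_sum L (n : nat) (F : 'I_n -> A) :
  is_ideal L -> (forall i, L (F i)) -> L (\sum_i F i).
Proof. by move=> [L0 LD _] LF; elim/big_ind: _. Qed.

Lemma ideal_opp L x : is_ideal L -> L x -> L (- x).
Proof. by move=> [_ _ LM] Lx; rewrite -mulN1r; exact: LM. Qed.

Lemma ideal_mul_is_ideal I J : is_ideal (ideal_mul I J).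
Proof. exact: ideal_span_is_ideal. Qed.

Lemma mem_ideal_mul I J x y : I x -> J y -> ideal_mul I J (x * y).
Proof. by move=> Ix Jy; apply: sub_gen_smallest; exists x => //; exists y. Qed.

Lemma ideal_mul_min I J L : is_ideal L ->
  (forall x y, I x -> J y -> L (x * y)) -> ideal_mul I J `<=` L.
Proof.
by move=> iL IJL; apply: ideal_span_min => // _ [x Ix [y Jy <-]]; exact: IJL.
Qed.

Lemma ideal_mulS I J K L : I `<=` K -> J `<=` L -> ideal_mul I J `<=` ideal_mul K L.
Proof.
move=> IK JL; apply: ideal_mul_min => [|x y /IK Kx /JL Ly].
  exact: ideal_mul_is_ideal.
exact: mem_ideal_mul.
Qed.

Lemma ideal_mulC : commutative (@ideal_mul A).
Proof.
suff sub I J : ideal_mul I J `<=` ideal_mul J I by move=> I J; apply/seteqP; split.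
apply: ideal_mul_min => [|x y Ix Jy]; first exact: ideal_mul_is_ideal.
by rewrite mulrC; exact: mem_ideal_mul.
Qed.

Lemma ideal_mulA : associative (@ideal_mul A).
Proof.
have sub I J K : ideal_mul I (ideal_mul J K) `<=` ideal_mul (ideal_mul I J) K.
  apply: ideal_mul_min => [|x y Ix]; first exact: ideal_mul_is_ideal.
  apply: (ideal_mul_min (ideal_colon x (ideal_mul_is_ideal _ _))) => u v Ju Kv /=.
  by rewrite mulrA; apply: mem_ideal_mul => //; exact: mem_ideal_mul.
move=> I J K; apply/seteqP; split; first exact: sub.
(* By commutativity the reverse inclusion is [sub] for the reversed triple [K], [J], [I]. *)
rewrite (ideal_mulC (ideal_mul I J)) (ideal_mulC I J).
by rewrite (ideal_mulC I (ideal_mul J K)) (ideal_mulC J K); exact: sub.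
Qed.

Lemma ideal_mulAC : right_commutative (@ideal_mul A).
Proof. by move=> I J K; rewrite -!ideal_mulA [ideal_mul J K]ideal_mulC. Qed.

Lemma ideal_mulCA : left_commutative (@ideal_mul A).
Proof. by move=> I J K; rewrite !ideal_mulA [ideal_mul I J]ideal_mulC. Qed.

Lemma ideal_mulACA : interchange (@ideal_mul A) (@ideal_mul A).
Proof. by move=> I J K L; rewrite -!ideal_mulA (ideal_mulCA J). Qed.

Lemma ideal_mul1 I : is_ideal I -> ideal_mul setT I = I.
Proof.
move=> iI; apply/seteqP; split=> [|x Ix]; last first.
  by rewrite -[x]mul1r; exact: mem_ideal_mul.
by apply: ideal_mul_min => // x y _ Iy; case: iI => _ _; apply.
Qed.

Definition principal f : set A := ideal_scale f setT.

(** Once scaling is a product of ideals, the multipliers in [ic_sim] can be moved around like any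
    other factor. *)
Lemma ideal_scaleE f I : is_ideal I ->
  ideal_scale f I = ideal_mul (principal f) I.
Proof.
move=> [I0 ID IM]; apply/seteqP; split.
  by move=> _ [x Ix <-]; apply: mem_ideal_mul => //; exists 1; rewrite ?mulr1.
apply: ideal_mul_min => [|_ y [a _ <-] Iy]; last first.
  by exists (a * y); rewrite ?mulrA //; exact: IM.
split; first by exists 0; rewrite ?mulr0.
  move=> _ _ [x Ix <-] [y Iy <-].
  by exists (x + y); rewrite ?mulrDr //; exact: ID.
by move=> a _ [x Ix <-]; exists (a * x); [exact: IM | rewrite mulrCA].
Qed.

Lemma ideal_principal f : is_ideal (principal f).
Proof.
split; first by exists 0; rewrite ?mulr0.
  by move=> _ _ [x _ <-] [y _ <-]; exists (x + y); rewrite ?mulrDr.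
by move=> a _ [x _ <-]; exists (a * x); rewrite // mulrCA.
Qed.

Lemma principalM f g : ideal_mul (principal f) (principal g) = principal (f * g).
Proof.
rewrite -ideal_scaleE; last exact: ideal_principal.
apply/seteqP; split=> [_ [_ [x _ <-] <-]|_ [x _ <-]].
  by exists x; rewrite ?mulrA.
by exists (g * x); rewrite ?mulrA //; exists x.
Qed.

Lemma ideal_exp_is_ideal I n : is_ideal (ideal_exp I n).
Proof. by case: n => [|n] /=; [exact: ideal_setT | exact: ideal_mul_is_ideal]. Qed.

Lemma mem_ideal_exp I n x : I x -> ideal_exp I n (x ^+ n).
Proof. by move=> Ix; elim: n => //= n IHn; rewrite exprS; exact: mem_ideal_mul. Qed.

(** * Ideals with a nonzerodivisor and the preorder [ideal_le] *)

Definition regular_ideal I : Prop := is_ideal I /\ exists2 x, I x & GRing.lreg x.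

Lemma regular_setT : regular_ideal setT.
Proof. by split; [exact: ideal_setT | exists 1 => //; exact: lreg1]. Qed.

Lemma regular_principal f : GRing.lreg f -> regular_ideal (principal f).
Proof.
move=> fr; split; first exact: ideal_principal.
by exists f => //; exists 1; rewrite ?mulr1.
Qed.

Lemma regular_mul I J :
  regular_ideal I -> regular_ideal J -> regular_ideal (ideal_mul I J).
Proof.
move=> [_ [x Ix xr]] [_ [y Jy yr]]; split; first exact: ideal_mul_is_ideal.
by exists (x * y); [exact: mem_ideal_mul | exact: lregM].
Qed.

Definition ideal_le I J : Prop :=
  exists2 N, regular_ideal N & ideal_mul I N `<=` ideal_mul J N.

Lemma sub_ideal_le I J : I `<=` J -> ideal_le I J.
Proof.
by move=> IJ; exists setT; [exact: regular_setT | exact: ideal_mulS].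
Qed.

Lemma ideal_le_refl I : ideal_le I I.
Proof. exact: sub_ideal_le. Qed.

(** The product of the two witnesses works: [I N M] lies in [J N M = J M N], which lies in
    [K M N]. *)
Lemma ideal_le_trans J I K : ideal_le I J -> ideal_le J K -> ideal_le I K.
Proof.
move=> [N rN IJ] [M rM JK]; exists (ideal_mul N M); first exact: regular_mul.
apply: (@subset_trans _ (ideal_mul (ideal_mul J M) N)).
  by rewrite ideal_mulA [X in _ `<=` X]ideal_mulAC; apply: ideal_mulS.
by rewrite (ideal_mulC N) ideal_mulA; apply: ideal_mulS.
Qed.

Lemma ideal_le_mul I J K L :
  ideal_le I J -> ideal_le K L -> ideal_le (ideal_mul I K) (ideal_mul J L).
Proof.
move=> [N rN IJ] [M rM KL]; exists (ideal_mul N M); first exact: regular_mul.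
by rewrite ![ideal_mul _ (ideal_mul N M)]ideal_mulACA; exact: ideal_mulS.
Qed.

(** If [N] is a witness for the products, then [K N] is one for [I] and [J]: the factor [K] is
    absorbed, not divided out. *)
Lemma ideal_le_cancel I J K : regular_ideal K ->
  ideal_le (ideal_mul I K) (ideal_mul J K) -> ideal_le I J.
Proof.
move=> rK [N rN IJ]; exists (ideal_mul K N); first exact: regular_mul.
by rewrite !ideal_mulA.
Qed.

(** * Lower-order terms of integral equations *)

(* The elements [c_1 x^(n-1) + ... + c_n] with [c_i] in [I^i]. *)
Fixpoint int_tail I x (n : nat) : set A :=
  if n is m.+1 then [set x * t + c | t in int_tail I x m & c in ideal_exp I n]
  else [set 0].

Lemma int_tail_is_ideal I x n : is_ideal (int_tail I x n).
Proof.
elim: n => [|n [T0 TD TM]] /=.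
  by split=> [//|_ _ -> ->|a _ ->]; rewrite ?addr0 ?mulr0.
have [E0 ED EM] := ideal_exp_is_ideal I n.+1.
split; first by exists 0 => //; exists 0; rewrite // mulr0 addr0.
  move=> _ _ [t Tt [c Ec <-]] [t' Tt' [c' Ec' <-]].
  exists (t + t'); first exact: TD.
  by exists (c + c'); [exact: ED | rewrite mulrDr addrACA].
move=> a _ [t Tt [c Ec <-]]; exists (a * t); first exact: TM.
by exists (a * c); [exact: EM | rewrite mulrDr mulrCA].
Qed.

Lemma int_tail_mulx I x n t : int_tail I x n t -> int_tail I x n.+1 (x * t).
Proof.
move=> Tt; exists t => //; exists 0; rewrite ?addr0 //.
by case: (ideal_exp_is_ideal I n.+1).
Qed.

(** A coefficient [c_i] in [I^i] becomes [a c_i] in [I^(i+1)], and its power of [x] is unchanged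
    because [n - i = (n+1) - (i+1)]. *)
Lemma int_tail_mul I x n a t :
  I a -> int_tail I x n t -> int_tail I x n.+1 (a * t).
Proof.
move=> Ia; elim: n t => [|n IHn] t.
  by move=> ->; rewrite mulr0; case: (int_tail_is_ideal I x 1).
move=> [u Tu [c Ec <-]]; exists (a * u); first exact: IHn.
by exists (a * c); [exact: mem_ideal_mul | rewrite mulrDr mulrCA].
Qed.

Lemma int_tail_exp I x n a : I a -> int_tail I x n.+1 (a * x ^+ n).
Proof.
move=> Ia; elim: n => [|n IHn]; last by rewrite exprS mulrCA; exact: int_tail_mulx.
exists 0 => //; exists (a * 1); first exact: mem_ideal_mul.
by rewrite mulr0 add0r.
Qed.

(** Passes from the Horner form, suited to induction, to the sum used in [int_closure]; the last
    constant [c] becomes the coefficient of index [n.+1]. *)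
Lemma int_tailP I x n t : int_tail I x n t ->
  exists2 a : nat -> A, forall i, (1 <= i <= n)%N -> ideal_exp I i (a i)
    & t = \sum_(1 <= i < n.+1) a i * x ^+ (n - i).
Proof.
elim: n t => [|n IHn] t.
  by move=> ->; exists (fun=> 0); [case | rewrite big_geq].
move=> [u /IHn[a aI ->] [c Ec <-]].
exists (fun i => if i == n.+1 then c else a i).
  move=> i /andP[i_gt0]; rewrite leq_eqVlt; case: eqP => [->//|_] /= i_le.
  by apply: aI; rewrite i_gt0.
rewrite [RHS]big_nat_recr //= eqxx subnn mulr1; congr (_ + _).
rewrite mulr_sumr; apply: eq_big_nat => i /andP[_ i_le].
by rewrite ltn_eqF // subSn // exprS mulrCA.
Qed.

(** Meant for one term of the Leibniz formula for [\det (x%:M + B)], with [b i] telling whether the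
    i-th factor is diagonal. In the expanded product only [x ^+ n] takes no factor from [I], and it
    occurs exactly when all [b i] hold. *)
Lemma int_tail_prod I x n (b : 'I_n -> bool) (a : 'I_n -> A) :
  (forall i, I (a i)) ->
  int_tail I x n (\prod_i (x *+ b i + a i) - x ^+ n *+ [forall i, b i]).
Proof.
elim: n b a => [|n IHn] b a Ia.
  have -> : [forall i : 'I_0, b i] by apply/forallP; case.
  by rewrite big_ord0 subrr.
set e := [forall i, b i].
set e' := [forall i, b (lift ord0 i)].
have -> : e = b ord0 && e'.
  apply/forallP/andP => [bi|[b0 /forallP bi] i].
    by split=> //; apply/forallP.
  by case: (unliftP ord0 i) => [j ->|->].
have {IHn} := IHn (b \o lift ord0) (a \o lift ord0) (fun i => Ia _).
rewrite -/e' big_ord_recl; set p := \prod_(i < n) _.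
move=> Tp; have [T0 TD TM] := int_tail_is_ideal I x n.+1.
have -> : (x *+ b ord0 + a ord0) * p - x ^+ n.+1 *+ (b ord0 && e') =
    (b ord0)%:R * (x * (p - x ^+ n *+ e')) + a ord0 * (p - x ^+ n *+ e')
    + e'%:R * (a ord0 * x ^+ n).
  (* Naming the tail part [q] of [p] leaves an identity to be checked for the four values of
     [b ord0] and [e']. *)
  have [q ->] : exists q, p = q + x ^+ n *+ e'.
    by exists (p - x ^+ n *+ e'); rewrite subrK.
  rewrite addrK; case: (b ord0); case: (e');
    rewrite /= ?mulr1n ?mulr0n ?mul1r ?mul0r ?subr0 ?add0r ?addr0 ?mulrDr ?mulrDl //.
  by rewrite -exprS addrACA addrAC addrK addrA.
apply: (TD); first apply: (TD).
- exact/TM/int_tail_mulx.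
- exact: int_tail_mul.
- exact/TM/int_tail_exp.
Qed.

(** The identity permutation contributes [x ^+ n] plus a tail. Any other permutation moves some
    index, so its term is a tail up to sign. *)
Lemma int_tail_det I x n (B : 'M[A]_n) : (forall i j, I (B i j)) ->
  int_tail I x n (\det (x%:M + B) - x ^+ n).
Proof.
move=> IB; rewrite /determinant (bigD1 (1%g : 'S_n)) //= odd_perm1 expr0 mul1r addrAC.
have [T0 TD TM] := int_tail_is_ideal I x n.
apply: (TD).
  have := int_tail_prod x (fun=> true) (fun i => IB i i).
  have -> : [forall i : 'I_n, true] by apply/forallP.
  congr (int_tail _ _ _ (_ - _)); apply: eq_bigr => i _.
  by rewrite perm1 !mxE eqxx.
elim/big_ind: _ => // s s1; apply: TM.
have := int_tail_prod x (fun i => i == s i) (fun i => IB i (s i)).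
have -> : [forall i, i == s i] = false.
  apply/negP => /forallP si; case/eqP: s1; apply/permP => i.
  by rewrite perm1 -(eqP (si i)).
rewrite mulr0n subr0; congr (int_tail _ _ _ _).
by apply: eq_bigr => i _; rewrite !mxE.
Qed.

(** * Integral dependence and stable ideals *)

Lemma ideal_mul_span_seq I s z : is_ideal I -> ideal_mul I (ideal_span [set` s]) z ->
  exists2 a : 'I_(size s) -> A, forall j, I (a j) & z = \sum_j a j * s`_j.
Proof.
move=> [I0 ID IM].
set L := [set z | exists2 a : 'I_(size s) -> A, forall j, I (a j)
  & z = \sum_j a j * s`_j].
have iL : is_ideal L.
  split; first by exists (fun=> 0) => //; rewrite big1 // => j _; rewrite mul0r.
    move=> _ _ [a Ia ->] [b Ib ->]; exists (fun j => a j + b j) => [j|].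
      exact: ID.
    by rewrite -big_split; apply: eq_bigr => j _; rewrite mulrDl.
  move=> c _ [a Ia ->]; exists (fun j => c * a j) => [j|]; first exact: IM.
  by rewrite mulr_sumr; apply: eq_bigr => j _; rewrite mulrA.
apply: (ideal_mul_min iL) => c y Ic.
apply: (ideal_span_min (L := [set y | L (c * y)])); first exact: ideal_colon.
move=> u /= us; have k_lt : (index u s < size s)%N by rewrite index_mem.
(* For a generator [u], all coefficients vanish except [c] at the first position of [u] in [s]. *)
exists (fun j => if j == Ordinal k_lt then c else 0) => [j|]; first by case: ifP.
rewrite (bigD1 (Ordinal k_lt)) //= eqxx nth_index // big1 ?addr0 // => j /negPf ->.
by rewrite mul0r.
Qed.

(** Expressing each [x * s_i] through the generators with coefficients in [I] gives a matrix
    [x%:M + B] that kills the column of generators. Its determinant then vanishes and expands to a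
    monic equation for [x]. *)
Lemma determinant_trick I s x : is_ideal I -> regular_ideal (ideal_span [set` s]) ->
    (forall y, ideal_span [set` s] y -> ideal_mul I (ideal_span [set` s]) (x * y)) ->
  int_closure I x.
Proof.
move=> iI [_ [r Mr rr]] xM.
have [I0 _ _] := iI.
have ex (i : 'I_(size s)) : exists a : 'I_(size s) -> A,
    (forall j, I (a j)) /\ x * s`_i = \sum_j a j * s`_j.
  have [|a Ia ->] := @ideal_mul_span_seq I s (x * s`_i) iI; last by exists a.
  by apply: xM; apply: sub_gen_smallest; exact: mem_nth.
have [a aP] := choice ex.
pose B := \matrix_(i, j) - a i j; pose v := \col_(i < size s) s`_i.
have Bv : (x%:M + B) *m v = 0.
  apply/colP => i; rewrite mulmxDl mul_scalar_mx !mxE (proj2 (aP i)).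
  by rewrite -big_split big1 //= => j _; rewrite !mxE mulNr subrr.
have dv : \det (x%:M + B) *: v = 0.
  by rewrite -mul_scalar_mx -mul_adj_mx -mulmxA Bv mulmx0.
(* The determinant kills every generator, hence the whole span, which contains the nonzerodivisor
   [r]. *)
have d0 : \det (x%:M + B) = 0.
  apply: rr; rewrite mulr0 mulrC.
  have i0 : is_ideal [set (0 : A)].
    by split=> [//|_ _ -> ->|c _ ->]; rewrite ?addr0 ?mulr0.
  apply: (ideal_span_min (ideal_colon _ i0) _ Mr) => u /= us.
  have k_lt : (index u s < size s)%N by rewrite index_mem.
  by have /colP/(_ (Ordinal k_lt)) := dv; rewrite !mxE /= nth_index.
have IB i j : I (B i j).
  by rewrite mxE; apply: ideal_opp => //; exact: (proj1 (aP i)).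
have := int_tail_det x IB; rewrite d0 sub0r.
(* Multiplying by [x] raises the degree to [(size s).+1], which is positive even for empty [s], as
   [int_closure] demands. *)
move=> /(int_tail_mulx)/int_tailP[c cI cE].
exists (size s).+1, c; split=> //.
by rewrite -cE mulrN -exprS subrr.
Qed.

Lemma int_closure_mul_stable I x : regular_ideal I -> int_closure I x ->
  exists2 N, regular_ideal N & forall y, N y -> ideal_mul I N (x * y).
Proof.
move=> [iI [b Ib br]] [[|m] [a [// _ aI xE]]].
(* This is [(I + (x))^m] given by generators; the equation for [x] has degree [m.+1]. *)
pose N := ideal_span [set y | exists2 i, (i <= m)%N
  & exists2 c, ideal_exp I i c & c * x ^+ (m - i) = y].
have GN i c : (i <= m)%N -> ideal_exp I i c -> N (c * x ^+ (m - i)).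
  by move=> im Ec; apply: sub_gen_smallest; exists i => //; exists c.
have iIN := ideal_mul_is_ideal I N.
have GIN i c : (i <= m)%N -> ideal_exp I i.+1 c -> ideal_mul I N (c * x ^+ (m - i)).
  move=> im; rewrite mulrC.
  apply: (ideal_mul_min (ideal_colon _ iIN)) => u v Iu Ev /=.
  by rewrite mulrC -mulrA; apply: mem_ideal_mul => //; exact: GN.
exists N.
  split; first exact: ideal_span_is_ideal.
  exists (b ^+ m); last exact: lregX.
  rewrite -[b ^+ m]mulr1 -(expr0 x) -(subnn m).
  by apply: GN => //; exact: mem_ideal_exp.
move=> y; apply: (ideal_span_min (ideal_colon _ iIN)).
(* On a generator with positive index, the extra [x] raises the power of [x] while one factor of [c]
   in [I] is split off. Index 0 produces [x ^+ m.+1], which the integral equation rewrites. *)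
move=> _ [[|i] im [c Ec <-]] /=; last first.
  by rewrite mulrCA -exprS -subSn // subSS; apply: GIN => //; exact: ltnW.
rewrite mulrCA -exprS subn0; case: (iIN) => [IN0 IND INM]; apply: (INM).
have -> : x ^+ m.+1 = - (\sum_(1 <= i < m.+2) a i * x ^+ (m.+1 - i)).
  by apply/eqP; rewrite -addr_eq0 xE.
apply: (ideal_opp iIN); rewrite big_add1 /= big_mkord.
apply: (ideal_sum iIN) => // i; rewrite subSS; apply: GIN; first by rewrite -ltnS.
by apply: aI => /=.
Qed.

End Ideals.

(** * Integral closure in a Noetherian ring *)

Section Noetherian.
Variables (A : comPzRingType) (noethA : noetherian A).
Implicit Types I J K N : set A.

(** The Noetherian hypothesis supplies the finite generating list of [N] on which the determinant
    trick operates. *)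
Lemma int_closureP I x : regular_ideal I ->
  int_closure I x <->
  exists2 N, regular_ideal N & forall y, N y -> ideal_mul I N (x * y).
Proof.
move=> rI; split; first exact: int_closure_mul_stable.
move=> [N rN xN]; have [s Ns] := noethA rN.1; rewrite Ns in rN xN.
exact: determinant_trick rI.1 rN xN.
Qed.

Lemma int_closure_le I x J : regular_ideal J -> ideal_le I J -> I x -> int_closure J x.
Proof.
move=> rJ [N rN IJ] Ix; apply/int_closureP => //; exists N => // y Ny.
by apply: IJ; exact: mem_ideal_mul.
Qed.

Lemma sub_int_closure I : regular_ideal I -> I `<=` int_closure I.
Proof. by move=> rI x; apply: int_closure_le => //; exact: ideal_le_refl. Qed.

(** For sums, the product [M N] of the witnesses for [x] and [y] serves both elements, hence also
    [x + y]. *)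
Lemma regular_int_closure I : regular_ideal I -> regular_ideal (int_closure I).
Proof.
move=> rI; split; last first.
  by have [_ [x Ix xr]] := rI; exists x => //; exact: sub_int_closure.
split; first by apply: sub_int_closure => //; case: rI => -[].
- move=> x y /int_closureP-/(_ rI)[M rM xM] /int_closureP-/(_ rI)[N rN yN].
  apply/int_closureP => //; exists (ideal_mul M N); first exact: regular_mul.
  have iL := ideal_mul_is_ideal I (ideal_mul M N).
  move=> z; apply: (ideal_mul_min (ideal_colon _ iL)) => u v Mu Nv /=.
  case: (iL) => _ LD _; rewrite mulrDl; apply: LD; rewrite ?ideal_mulA mulrA.
    by apply: mem_ideal_mul => //; exact: xM.
  by rewrite ideal_mulAC mulrAC; apply: mem_ideal_mul => //; exact: yN.
- move=> a x /int_closureP-/(_ rI)[N rN xN]; apply/int_closureP => //.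
  exists N => // y Ny; rewrite -mulrA.
  by case: (ideal_mul_is_ideal I N) => _ _; apply; exact: xN.
Qed.

(** The closure is finitely generated, so the product of the witnesses of its generators is a single
    witness for all of it. *)
Lemma int_closure_ideal_le I : regular_ideal I -> ideal_le (int_closure I) I.
Proof.
move=> rI; have [s sE] := noethA (regular_int_closure rI).1.
have : [set` s] `<=` int_closure I by rewrite sE; exact: sub_gen_smallest.
(* Only the closure to be bounded becomes a span, so the induction runs over arbitrary lists of
   elements integral over [I]. *)
rewrite {2}sE; elim: s {sE} => [|x s IHs] xsI.
  exists setT; first exact: regular_setT.
  apply: (ideal_mul_min (ideal_mul_is_ideal _ _)) => u v su _.
  rewrite mulrC; apply: (ideal_span_min (ideal_colon _ (ideal_mul_is_ideal _ _)) _ su).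
  by [].
have [N rN sN] : ideal_le (ideal_span [set` s]) I.
  by apply: IHs => y /= ys; apply: xsI; rewrite /= in_cons ys orbT.
have /int_closureP-/(_ rI)[M rM xM] : int_closure I x.
  by apply: xsI; rewrite /= mem_head.
exists (ideal_mul M N); first exact: regular_mul.
have iL := ideal_mul_is_ideal I (ideal_mul M N).
apply: (ideal_mul_min iL) => u v su MNv; rewrite mulrC.
apply: (ideal_span_min (ideal_colon _ iL) _ su) => y /=; rewrite mulrC.
rewrite in_cons => /predU1P[->|ys];
  apply: (ideal_mul_min (ideal_colon _ iL) _ MNv) => a b Ma Nb /=.
  by rewrite mulrA ideal_mulA; apply: mem_ideal_mul => //; exact: xM.
rewrite mulrCA ideal_mulCA; apply: mem_ideal_mul => //; apply: sN.
by apply: mem_ideal_mul => //; exact: sub_gen_smallest.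
Qed.

Lemma sub_int_closureP I J : regular_ideal J ->
  I `<=` int_closure J <-> ideal_le I J.
Proof.
move=> rJ; split=> [IJ|IJ x]; last exact: int_closure_le.
by apply: ideal_le_trans (int_closure_ideal_le rJ); exact: sub_ideal_le.
Qed.

(** For regular ideals this is equality of integral closures, by [int_closure_eqP], in a form that
    multiplies and cancels directly. *)
Definition ideal_eqv I J : Prop := ideal_le I J /\ ideal_le J I.

Lemma ideal_eqv_refl I : ideal_eqv I I.
Proof. by split; exact: ideal_le_refl. Qed.

Lemma ideal_eqv_sym I J : ideal_eqv I J -> ideal_eqv J I.
Proof. by case. Qed.

Lemma ideal_eqv_trans J I K : ideal_eqv I J -> ideal_eqv J K -> ideal_eqv I K.
Proof.
by move=> [IJ JI] [JK KJ]; split; [exact: ideal_le_trans JK | exact: ideal_le_trans JI].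
Qed.

Lemma ideal_eqv_mul I J K L : ideal_eqv I J -> ideal_eqv K L ->
  ideal_eqv (ideal_mul I K) (ideal_mul J L).
Proof. by move=> [IJ JI] [KL LK]; split; exact: ideal_le_mul. Qed.

Lemma ideal_eqv_cancel I J K : regular_ideal K ->
  ideal_eqv (ideal_mul I K) (ideal_mul J K) -> ideal_eqv I J.
Proof. by move=> rK [IJ JI]; split; exact: ideal_le_cancel rK _. Qed.

Lemma int_closure_eqv I : regular_ideal I -> ideal_eqv (int_closure I) I.
Proof.
move=> rI; split; first exact: int_closure_ideal_le.
by apply: sub_ideal_le; exact: sub_int_closure.
Qed.

Lemma int_closure_eqP I J : regular_ideal I -> regular_ideal J ->
  int_closure I = int_closure J <-> ideal_eqv I J.
Proof.
move=> rI rJ; split=> [eIJ|[IJ JI]].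
  apply: (ideal_eqv_trans (ideal_eqv_sym (int_closure_eqv rI))).
  by rewrite eIJ; exact: int_closure_eqv.
apply/seteqP; split; apply/sub_int_closureP => //.
  exact: ideal_le_trans (int_closure_ideal_le rI) IJ.
exact: ideal_le_trans (int_closure_ideal_le rJ) JI.
Qed.

(** * The monoid of integrally closed ideals and its congruence *)

Lemma ic_regular I : ic I -> regular_ideal I.
Proof. by case. Qed.

Lemma int_closure_ic I : regular_ideal I -> ic (int_closure I).
Proof.
move=> rI; have rcI := regular_int_closure rI; split; [exact: rcI.1 | | exact: rcI.2].
by apply/int_closure_eqP => //; exact: int_closure_eqv.
Qed.

Lemma ic_mul_ic I J : ic I -> ic J -> ic (ic_mul I J).
Proof. by move=> /ic_regular rI /ic_regular rJ; exact/int_closure_ic/regular_mul. Qed.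

Lemma ic_mul_eqv I J : ic I -> ic J -> ideal_eqv (ic_mul I J) (ideal_mul I J).
Proof. by move=> /ic_regular rI /ic_regular rJ; exact/int_closure_eqv/regular_mul. Qed.

Lemma ic_comm_monoid : comm_monoid (@ic A) (@ic_mul A) setT.
Proof.
split.
- split; [exact: ideal_setT | | exact: (regular_setT A).2].
  by apply/seteqP; split=> // x _; apply: sub_int_closure => //; exact: regular_setT.
- exact: ic_mul_ic.
- move=> I J K iI iJ iK; have rI := ic_regular iI; have rK := ic_regular iK.
  have iIJ := ic_mul_ic iI iJ; have iJK := ic_mul_ic iJ iK.
  apply/int_closure_eqP.
  + exact/regular_mul/ic_regular.
  + by apply: regular_mul => //; exact: ic_regular.
  (* Both bracketings are equivalent to the plain triple product, where associativity is known. *)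
  apply: (@ideal_eqv_trans (ideal_mul I (ideal_mul J K))).
    by apply: ideal_eqv_mul; [exact: ideal_eqv_refl | exact: ic_mul_eqv].
  rewrite ideal_mulA; apply: ideal_eqv_mul; last exact: ideal_eqv_refl.
  exact/ideal_eqv_sym/ic_mul_eqv.
- by move=> I J _ _; rewrite /ic_mul ideal_mulC.
- by move=> I [iI cI _]; rewrite /ic_mul ideal_mul1.
Qed.

Lemma ic_simP I J : regular_ideal I -> regular_ideal J ->
  ic_sim I J <->
  exists f g : A, [/\ GRing.lreg f, GRing.lreg g
    & ideal_eqv (ideal_mul (principal f) I) (ideal_mul (principal g) J)].
Proof.
move=> rI rJ; have [iI _] := rI; have [iJ _] := rJ.
have E f g : GRing.lreg f -> GRing.lreg g ->
    int_closure (ideal_scale f I) = int_closure (ideal_scale g J) <->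
    ideal_eqv (ideal_mul (principal f) I) (ideal_mul (principal g) J).
  move=> fr gr; rewrite !ideal_scaleE //.
  by apply: int_closure_eqP; apply: regular_mul => //; exact: regular_principal.
by split=> -[f [g [fr gr /(E _ _ fr gr) fg]]]; exists f, g.
Qed.

Lemma ic_sim_congruence : congruence (@ic A) (@ic_mul A) (@ic_sim A).
Proof.
split; first split.
- by move=> I _; exists 1, 1; split=> //; exact: lreg1.
- by move=> I J _ _ [f [g [fr gr E]]]; exists g, f.
- move=> I J K /ic_regular rI /ic_regular rJ /ic_regular rK.
  move=> /ic_simP-/(_ rI rJ)[f [g [fr gr IJ]]] /ic_simP-/(_ rJ rK)[h [k [hr kr JK]]].
  (* From [f I ~ g J] and [h J ~ k K] follows [h f I ~ h g J = g h J ~ g k K]. *)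
  apply/ic_simP => //; exists (h * f), (g * k); split; try exact: lregM.
  rewrite -!principalM -!ideal_mulA.
  apply: (@ideal_eqv_trans (ideal_mul (principal h) (ideal_mul (principal g) J))).
    by apply: ideal_eqv_mul => //; exact: ideal_eqv_refl.
  by rewrite ideal_mulCA; apply: ideal_eqv_mul => //; exact: ideal_eqv_refl.
- move=> I J K H icI icJ icK icH.
  have rI := ic_regular icI; have rJ := ic_regular icJ.
  have rK := ic_regular icK; have rH := ic_regular icH.
  move=> /ic_simP-/(_ rI rJ)[f [g [fr gr IJ]]] /ic_simP-/(_ rK rH)[h [k [hr kr KH]]].
  apply/ic_simP; try exact/ic_regular/ic_mul_ic.
  exists (f * h), (g * k); split; try exact: lregM.
  rewrite -!principalM.
  (* Removes the closure inside [ic_mul], leaving products of ideals whose factors can be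
     regrouped. *)
  have E U V P : ic U -> ic V ->
      ideal_eqv (ideal_mul P (ic_mul U V)) (ideal_mul P (ideal_mul U V)).
    move=> icU icV.
    by apply: ideal_eqv_mul; [exact: ideal_eqv_refl | exact: ic_mul_eqv].
  apply: (ideal_eqv_trans (E _ _ _ icI icK)).
  apply: ideal_eqv_trans (ideal_eqv_sym (E _ _ _ icJ icH)).
  by rewrite ideal_mulACA [X in ideal_eqv _ X]ideal_mulACA; exact: ideal_eqv_mul.
Qed.

(** The same [f] and [g] serve: without closures the hypothesis reads [f I K ~ g J K], and the
    regular factor [K] cancels. *)
Lemma ic_sim_cancel I J K : ic I -> ic J -> ic K ->
  ic_sim (ic_mul I K) (ic_mul J K) -> ic_sim I J.
Proof.
move=> icI icJ icK; have rK := ic_regular icK.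
have rIK := ic_regular (ic_mul_ic icI icK); have rJK := ic_regular (ic_mul_ic icJ icK).
move=> /ic_simP-/(_ rIK rJK)[f [g [fr gr IJ]]].
apply/ic_simP; try exact: ic_regular.
exists f, g; split=> //; apply: (ideal_eqv_cancel rK); rewrite -!ideal_mulA.
have E U P : ic U -> ideal_eqv (ideal_mul P (ic_mul U K)) (ideal_mul P (ideal_mul U K)).
  by move=> icU; apply: ideal_eqv_mul; [exact: ideal_eqv_refl | exact: ic_mul_eqv].
apply: (ideal_eqv_trans (ideal_eqv_sym (E _ _ icI))).
exact: ideal_eqv_trans (E _ _ icJ).
Qed.

End Noetherian.

Theorem theorem1p3 (A : comPzRingType) (noethA : noetherian A) :
  [/\ comm_monoid (@ic A) (@ic_mul A) setT,
      congruence (@ic A) (@ic_mul A) (@ic_sim A),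
      comm_monoid (quot (@ic A) (@ic_sim A))
                  (quot_op (@ic A) (@ic_mul A) (@ic_sim A))
                  (eq_class (@ic A) (@ic_sim A) setT)
    & cancellative (quot (@ic A) (@ic_sim A))
                   (quot_op (@ic A) (@ic_mul A) (@ic_sim A))].
Proof.
have icM := ic_comm_monoid noethA; have simC := ic_sim_congruence noethA.
split=> //; first exact: comm_monoid_quot.
apply: cancellative_quot => //; first by case: icM.
exact: ic_sim_cancel.
Qed.
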